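(* Let $S$ be a bzi-semiring. A $z$-ideal of $S$ is $z$-prime if and only if it is both $z$-semiprime and $z$-strongly irreducible.
   Context: A (commutative) semiring is a system $(S,+,0,\cdot,1)$ with $(S,+,0)$ and $(S,\cdot,1)$ commutative monoids, $0s=0$ for all $s\in S$, and multiplication distributing over addition. An ideal of $S$ is a nonempty subset closed under addition and under multiplication by elements of $S$; it is proper if it is not $S$. The product $\mathfrak{a}\mathfrak{b}$ of ideals is the ideal generated by $\{ab\mid a\in\mathfrak{a},b\in\mathfrak{b}\}$. $\mathrm{Max}(S)$ is the set of maximal (proper) ideals of $S$, and for $x\in S$, $\mathcal{M}_x=\{\mathfrak{m}\in\mathrm{Max}(S)\mid x\in\mathfrak{m}\}$. An ideal $\mathfrak{z}$ of $S$ is a $z$-ideal if $\bigcap\mathcal{M}_x\subseteq\mathfrak{z}$ for every $x\in\mathfrak{z}$ (the intersection of the empty family is $S$). A basic $z$-ideal is an ideal of the form $\mathsf{m}_x=\bigcap\mathcal{M}_x$, $x\in S$; $S$ is a bzi-semiring if $\mathsf{m}_x\mathsf{m}_x=\mathsf{m}_x$ for all $x\in S$. A proper $z$-ideal $\mathfrak{p}$ is $z$-prime if for all $z$-ideals $\mathfrak{a},\mathfrak{b}$, $\mathfrak{a}\mathfrak{b}\subseteq\mathfrak{p}$ implies $\mathfrak{a}\subseteq\mathfrak{p}$ or $\mathfrak{b}\subseteq\mathfrak{p}$. A proper $z$-ideal $\mathfrak{p}$ is $z$-semiprime if for all $z$-ideals $\mathfrak{a}$, $\mathfrak{a}^2\subseteq\mathfrak{p}$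 implies $\mathfrak{a}\subseteq\mathfrak{p}$. A $z$-ideal $\mathfrak{a}$ is $z$-strongly irreducible if for all $z$-ideals $\mathfrak{b},\mathfrak{b}'$, $\mathfrak{b}\cap\mathfrak{b}'\subseteq\mathfrak{a}$ implies $\mathfrak{b}\subseteq\mathfrak{a}$ or $\mathfrak{b}'\subseteq\mathfrak{a}$. *)

(* Defs.v *)
From mathcomp Require Import all_boot all_algebra.
From mathcomp Require Import boolp classical_sets.

Set Implicit Arguments.
Unset Strict Implicit.
Unset Printing Implicit Defensive.

Import GRing.Theory.
Local Open Scope classical_set_scope.
Local Open Scope ring_scope.

(* Semirings are [comPzSemiRingType]: commutative, with absorbing 0, and with
   1 = 0 allowed. *)

Definition ideal (S : comPzSemiRingType) (I : set S) : Prop :=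
  [/\ I !=set0,
      forall x y, I x -> I y -> I (x + y)
    & forall s x, I x -> I (s * x)].

Definition proper_ideal (S : comPzSemiRingType) (I : set S) : Prop :=
  ideal I /\ I <> setT.

Definition ideal_generated (S : comPzSemiRingType) (A : set S) : set S :=
  smallest (@ideal S) A.

Definition ideal_product (S : comPzSemiRingType) (I J : set S) : set S :=
  ideal_generated [set x * y | x in I & y in J].

Definition Max (S : comPzSemiRingType) : set (set S) :=
  [set m | proper_ideal m /\
           forall J : set S, proper_ideal J -> m `<=` J -> J = m].

Definition Max_containing (S : comPzSemiRingType) (x : S) : set (set S) :=
  [set m | Max m /\ m x].

(* When no maximal ideal contains x, this is the whole of S. *)
Definition basic_z_ideal (S : comPzSemiRingType) (x : S) : set S :=
  \bigcap_(m in Max_containing x) m.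

Definition z_ideal (S : comPzSemiRingType) (z : set S) : Prop :=
  ideal z /\ forall x, z x -> basic_z_ideal x `<=` z.

Definition bzi_semiring (S : comPzSemiRingType) : Prop :=
  forall x : S,
    ideal_product (basic_z_ideal x) (basic_z_ideal x) = basic_z_ideal x.

Definition z_prime (S : comPzSemiRingType) (p : set S) : Prop :=
  [/\ z_ideal p, p <> setT
    & forall a b : set S, z_ideal a -> z_ideal b ->
        ideal_product a b `<=` p -> a `<=` p \/ b `<=` p].

Definition z_semiprime (S : comPzSemiRingType) (p : set S) : Prop :=
  [/\ z_ideal p, p <> setT
    & forall a : set S, z_ideal a -> ideal_product a a `<=` p -> a `<=` p].

Definition z_strongly_irreducible (S : comPzSemiRingType) (a : set S) : Prop :=
  z_ideal a /\
  forall b b' : set S, z_ideal b -> z_ideal b' ->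
    b `&` b' `<=` a -> b `<=` a \/ b' `<=` a.

(* Main.v *)
Require Import Defs.
From mathcomp Require Import all_boot all_algebra.
From mathcomp Require Import boolp classical_sets.

(** A z-prime ideal is z-strongly irreducible because [ab] lies in the
    intersection of [a] and [b].  Conversely, if [ab] lies in [p] then the
    z-ideal [c], the intersection of [a] and [b], satisfies [c^2 <= ab <= p], so
    z-semiprimeness gives [c <= p], and z-strong irreducibility gives [a <= p]
    or [b <= p]. *)

Import GRing.Theory.
Local Open Scope classical_set_scope.
Local Open Scope ring_scope.

Lemma ideal0 (S : comPzSemiRingType) (I : set S) : ideal I -> I 0.
Proof. by case=> -[x Ix] _ IM; rewrite -(mul0r x); exact: IM. Qed.

Lemma idealI (S : comPzSemiRingType) (I J : set S) :
  ideal I -> ideal J -> ideal (I `&` J).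
Proof.
move=> idI idJ; have [_ ID IM] := idI; have [_ JD JM] := idJ.
(* The elements witnessing nonemptiness of [I] and [J] may differ, but 0 is common to both. *)
split; first by exists 0; split; exact: ideal0.
- by move=> x y [Ix Jx] [Iy Jy]; split; [exact: ID | exact: JD].
- by move=> s x [Ix Jx]; split; [exact: IM | exact: JM].
Qed.

Lemma z_idealI (S : comPzSemiRingType) (I J : set S) :
  z_ideal I -> z_ideal J -> z_ideal (I `&` J).
Proof.
move=> [idI zI] [idJ zJ]; split; first exact: idealI.
by move=> x [Ix Jx] y mxy; split; [exact: zI Ix _ mxy | exact: zJ Jx _ mxy].
Qed.

Lemma ideal_productS (S : comPzSemiRingType) (I I' J J' : set S) :
  I `<=` I' -> J `<=` J' -> ideal_product I J `<=` ideal_product I' J'.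
Proof.
move=> II' JJ' z IJz K [idK IJK]; apply: IJz; split=> // _ [x Ix [y Jy <-]].
by apply: IJK; exists x; [exact: II' | exists y; [exact: JJ' |]].
Qed.

(** Each generator [x * y] is a multiple of [x] and of [y], so the intersection is one of the ideals
    over which [smallest] intersects. *)
Lemma ideal_product_subI (S : comPzSemiRingType) (I J : set S) :
  ideal I -> ideal J -> ideal_product I J `<=` I `&` J.
Proof.
move=> idI idJ z; apply; split; first exact: idealI.
have [_ _ IM] := idI; have [_ _ JM] := idJ.
by move=> _ [x Ix [y Jy <-]]; split; [rewrite mulrC; exact: IM | exact: JM].
Qed.

Theorem proposition4p23 (S : comPzSemiRingType) (hS : bzi_semiring S)
  (p : set S) (hp : z_ideal p) :
  z_prime p <-> z_semiprime p /\ z_strongly_irreducible p.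
Proof.
split=> [[_ pT primep] | [[_ pT semip] [_ irrp]]].
(* With both ideals equal to [a], the two alternatives of primeness coincide. *)
- split; split=> //; first by move=> a za aap; case: (primep a a za za aap).
  move=> a b za zb abp; apply: primep => //; apply: subset_trans abp.
  by apply: ideal_product_subI; [case: za | case: zb].
- split=> // a b za zb abp; apply: irrp => //.
  apply: semip; first exact: z_idealI.
  apply: subset_trans abp.
  by apply: ideal_productS; [exact: subIsetl | exact: subIsetr].
Qed.
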